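(* Let $R$ be a domain and let $M$ be a cl.Hilbert $R$-module. If $N$ is any submodule of $M$ such that $M/N$ is a torsion-free $R$-module, then $N$ is also a cl.Hilbert $R$-module.
   Context: All rings are commutative with identity $1\neq 0$ and all modules are unital. A proper submodule $P$ of an $R$-module $M$ is classical prime if for all $a,b\in R$ and $m\in M$, $abm\in P$ implies $am\in P$ or $bm\in P$. An $R$-module $M$ is a cl.Hilbert module (classical Hilbert module) if every classical prime submodule of $M$ is an intersection of maximal submodules of $M$. *)

(* Defs.v *)
From HB Require Import structures.
From mathcomp Require Import all_boot all_algebra.

Set Implicit Arguments.
Unset Strict Implicit.
Unset Printing Implicit Defensive.

Import GRing.Theory.

Local Open Scope ring_scope.
Local Open Scope quotient_scope.

(* Submodules of M are MathComp's [submodClosed M], i.e. boolean predicates.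
   Under excluded middle and unique choice every Prop-valued submodule is of
   this form.  Two submodules are equal as sets when they are related by =i. *)

Section SubAndQuotientModule.
Variables (R : nzRingType) (M : lmodType R) (N : submodClosed M).

Inductive submodule_of : predArgType := Submodule x of x \in N.
Definition submodule_val (u : submodule_of) := let: Submodule x _ := u in x.

HB.instance Definition _ := [isSub for submodule_val].
HB.instance Definition _ := [Choice of submodule_of by <:].
HB.instance Definition _ := [SubChoice_isSubLmodule of submodule_of by <:].

(* [SubmodClosed] does not inherit from [ZmodClosed] (it is stated over
   semirings), hence this copy of N on which the group quotient can be formed. *)
Definition submodule_pred : {pred M} := fun x => x \in N.

Lemma submodule_pred_zmod_closed : zmod_closed submodule_pred.
Proof. exact: GRing.submod_closedB (GRing.submodClosedP N). Qed.

HB.instance Definition _ :=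
  GRing.isZmodClosed.Build M submodule_pred submodule_pred_zmod_closed.

Definition quotient_module := Quotient.quot submodule_pred.
Local Notation Q := quotient_module.

HB.instance Definition _ := GRing.Zmodule.on Q.
HB.instance Definition _ : EqQuotient M (Quotient.equiv submodule_pred) Q :=
  EqQuotient.on Q.
HB.instance Definition _ :
  isZmodQuotient M (Quotient.equiv submodule_pred) 0 -%R +%R Q :=
  ZmodQuotient.on Q.

Definition quotient_scale (a : R) : Q -> Q := lift_op1 Q (fun x => a *: x).

Lemma pi_quotient_scale a (x : M) :
  quotient_scale a (\pi_Q x) = \pi_Q (a *: x).
Proof.
rewrite /quotient_scale; unlock; apply/eqP; rewrite piE Quotient.equivE.
rewrite -scalerBr; apply: rpredZ.
have: repr (\pi_Q x) = x %[mod Q] by rewrite reprK.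
by move=> /eqP; rewrite piE Quotient.equivE.
Qed.

Lemma quotient_scaleA a b v :
  quotient_scale a (quotient_scale b v) = quotient_scale (a * b) v.
Proof. by rewrite -[v]reprK !pi_quotient_scale scalerA. Qed.

Lemma quotient_scale1 : left_id 1 quotient_scale.
Proof. by move=> v; rewrite -[v]reprK pi_quotient_scale scale1r. Qed.

Lemma quotient_scaleDr : right_distributive quotient_scale +%R.
Proof.
move=> a u v; rewrite -[u]reprK -[v]reprK -raddfD !pi_quotient_scale.
by rewrite scalerDr raddfD.
Qed.

Lemma quotient_scaleDl v : {morph quotient_scale^~ v : a b / a + b}.
Proof.
by move=> a b /=; rewrite -[v]reprK !pi_quotient_scale scalerDl raddfD.
Qed.

HB.instance Definition _ := GRing.Zmodule_isLmodule.Build R Q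
  quotient_scaleA quotient_scale1 quotient_scaleDr quotient_scaleDl.

End SubAndQuotientModule.

Arguments submodule_of {R M} N.
Arguments quotient_module {R M} N.

Section Modules.
Variables (R : comNzRingType) (M : lmodType R).
Implicit Types P K L : submodClosed M.

Definition proper_submodule P : Prop := exists x : M, x \notin P.

Definition classical_prime P : Prop :=
  proper_submodule P /\
  forall (a b : R) (m : M), (a * b) *: m \in P -> a *: m \in P \/ b *: m \in P.

Definition maximal_submodule K : Prop :=
  proper_submodule K /\
  forall L, proper_submodule L -> {subset K <= L} -> L =i K.

Definition inter_of_maximal P : Prop :=
  exists F : submodClosed M -> Prop,
    (forall K, F K -> maximal_submodule K) /\
    (forall x : M, x \in P <-> (forall K, F K -> x \in K)).

End Modules.

Definition cl_Hilbert (R : comNzRingType) (M : lmodType R) : Prop :=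
  forall P : submodClosed M, classical_prime P -> inter_of_maximal P.

Definition torsion_free (R : idomainType) (M : lmodType R) : Prop :=
  forall (a : R) (m : M), a *: m = 0 -> a = 0 \/ m = 0.

(* Main.v *)
From HB Require Import structures.
Require Import Defs.
From mathcomp Require Import all_boot all_algebra.
From mathcomp Require Import boolp.

(** A classical prime submodule P of N is already classical prime in M: if
    a b <> 0 and a b m lies in P, hence in N, then torsion-freeness of M / N puts
    m in N, where primality applies.  So P is an intersection of maximal
    submodules K of M.  Those containing N do not matter; for the others,
    N / (K ∩ N) is isomorphic to (N + K) / K = M / K, which is simple, so K ∩ N is
    maximal in N. *)

Set Implicit Arguments.
Unset Strict Implicit.
Unset Printing Implicit Defensive.

Import GRing.Theory.

Local Open Scope ring_scope.
Local Open Scope quotient_scope.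

Lemma submodClosed_of (R : nzRingType) (M : lmodType R) (p : {pred M}) :
  submod_closed p -> exists P : submodClosed M, P =i p.
Proof.
move=> /GRing.submod_closed_semi pS.
pose pM := GRing.isSubmodClosed.Build R M p pS.
by exists (HB.pack_for (submodClosed M) (p : M -> bool) pM).
Qed.

Section Submodule.
Variables (R : nzRingType) (M : lmodType R) (N : submodClosed M).
Implicit Types (K : submodClosed M) (P L : submodClosed (submodule_of N)).

Lemma submodule_comap K :
  exists P, forall u : submodule_of N, (u \in P) = (val u \in K).
Proof.
have [|P defP] := @submodClosed_of R (submodule_of N) [pred u | val u \in K].
  split=> [|a u v]; rewrite !inE ?(raddf0 val) ?rpred0 //.
  by rewrite raddfD /= => uK vK; rewrite rpredD ?rpredZ.
by exists P => u; rewrite defP inE.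
Qed.

(** [J] is the sum P + K formed inside M. With K = 0 it carries P over to M; with K maximal it is
    the submodule on which maximality of K is tested. *)
Lemma submodule_join P K :
  exists J : submodClosed M, forall x,
    x \in J <-> exists2 u : submodule_of N, u \in P & x - val u \in K.
Proof.
(* Membership in a sum is an existential, made boolean by excluded middle. *)
pose p : {pred M} :=
  fun x => `[< exists2 u : submodule_of N, u \in P & x - val u \in K >].
have [|J defJ] := @submodClosed_of R M p.
  split=> [|a x y /asboolP[u uP xu] /asboolP[v vP yv]]; apply/asboolP.
    by exists 0; rewrite ?rpred0 // (raddf0 val) subr0 rpred0.
  exists (a *: u + v); first by rewrite rpredD ?rpredZ.
  rewrite (raddfD val) /= opprD addrACA -scalerBr.
  by rewrite rpredD ?rpredZ.
by exists J => x; rewrite defJ; split=> [/asboolP|?]; last exact/asboolP.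
Qed.

Lemma submodule_map P :
  exists Q : submodClosed M,
    (forall x, x \in Q -> x \in N) /\
    (forall u : submodule_of N, (val u \in Q) = (u \in P)).
Proof.
have [K0 defK0] : exists K0 : submodClosed M, K0 =i [pred x | x == 0].
  apply: submodClosed_of; split=> [|a x y]; rewrite !inE //.
  by move=> /eqP-> /eqP->; rewrite scaler0 addr0.
(* The image of P in M is obtained as P + 0. *)
have [Q defQ] := submodule_join P K0; exists Q; split=> [x|u].
  by case/defQ=> u uP; rewrite defK0 inE subr_eq0 => /eqP->; exact: valP.
apply/idP/idP=> [/defQ[v vP]|uP].
  by rewrite defK0 inE subr_eq0 => /eqP/val_inj->.
by apply/defQ; exists u; rewrite // subrr rpred0.
Qed.

End Submodule.

Lemma torsion_free_quotient (R : idomainType) (M : lmodType R)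
    (N : submodClosed M) (a : R) (m : M) :
  torsion_free (quotient_module N) -> a != 0 -> a *: m \in N -> m \in N.
Proof.
move=> tfN a_neq0 amN.
have pi_eq0 x : (\pi_(quotient_module N) x == 0) = (x \in N).
  by rewrite piE Quotient.equivE subr0.
have /tfN[a_eq0|/eqP] : a *: \pi_(quotient_module N) m = 0.
- by apply/eqP; rewrite [_ *: _]pi_quotient_scale pi_eq0.
- by rewrite a_eq0 eqxx in a_neq0.
- by rewrite pi_eq0.
Qed.

(** If L is proper in N and contains K ∩ N, the modular law gives (L + K) ∩ N = L + (K ∩ N) = L. So
    L + K is proper in M, hence equals K, and L lies in K ∩ N. *)
Lemma maximal_comap (R : comNzRingType) (M : lmodType R)
    (N K : submodClosed M) (P : submodClosed (submodule_of N)) :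
  maximal_submodule K -> (exists2 x, x \in N & x \notin K) ->
  (forall u : submodule_of N, (u \in P) = (val u \in K)) ->
  maximal_submodule P.
Proof.
move=> [_ maxK] [x xN xK] defP; split; first by exists (Submodule xN); rewrite defP.
move=> L [v vL] PL u; apply/idP/idP=> [uL|/PL//]; rewrite defP.
have [J defJ] := submodule_join L K.
rewrite -(maxK J).
- by apply/defJ; exists u; rewrite // subrr rpred0.
- exists (val v); apply: contra vL => /defJ[w wL vwK].
  by rewrite -(subrK w v) rpredD // PL // defP raddfB.
- by move=> y yK; apply/defJ; exists 0; rewrite ?rpred0 // (raddf0 val) subr0.
Qed.

Theorem proposition2p13 (R : idomainType) (M : lmodType R) :
  cl_Hilbert M ->
  forall N : submodClosed M,
    torsion_free (quotient_module N) -> cl_Hilbert (submodule_of N).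
Proof.
move=> hilbM N tfN P [[v vP] primeP].
have [Q [QN defQ]] := submodule_map P.
have primeQ : classical_prime Q.
  split=> [|a b m abmQ]; first by exists (val v); rewrite defQ.
  (* Torsion-freeness is no help when ab = 0, but then a or b vanishes, R being a domain. *)
  have [/eqP|ab_neq0] := eqVneq (a * b) 0.
    by rewrite mulf_eq0 => /orP[]/eqP->; rewrite scale0r rpred0; [left|right].
  have mN := torsion_free_quotient tfN ab_neq0 (QN _ abmQ).
  pose u : submodule_of N := Submodule mN.
  have valZ c : c *: m = val (c *: u) by rewrite linearZ.
  by move: abmQ; rewrite !valZ !defQ; exact: primeP.
have [F [maxF defF]] := hilbM Q primeQ.
(* Requiring the trace on N to be maximal discards the K that contain N, whose trace is all of N. *)
exists (fun L => maximal_submodule L /\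
  exists2 K, F K & forall u : submodule_of N, (u \in L) = (val u \in K)).
split=> [L []//|u]; rewrite -defQ defF; split=> [uF L [_ [K FK ->]]|uF K FK].
  exact: uF.
have [L defL] := submodule_comap N K.
(* A u outside K itself witnesses that N is not inside K, so the trace of K is in the family. *)
apply: contraT => uK; suff: u \in L by rewrite defL (negPf uK).
apply: uF; split; last by exists K.
apply: maximal_comap (maxF K FK) _ defL.
by exists (val u); first exact: valP.
Qed.
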